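(* Let $f,g$ be non-degenerate real ternary quadratic forms generating a pencil in orbit II or IIa. (1) If it is in orbit II, then $p_2<0$ and $\Phi_{30}A_1>0$. (2) If it is in orbit IIa, then $p_2=0$ or $\Phi_{30}A_1<0$.
   Context: A pencil of conics is a projective line in $\mathbb{P}(S^2{\mathbb{R}^3}^* )$. Orbits of pencils are under $PGL(3,\mathbb{R})$: orbit II is the orbit of the pencil generated by $yz$ and $x(y-z)$; orbit IIa that of the pencil generated by $y^2+z^2$ and $xz$. Let $\mathrm{Matrix}(q)$ be the symmetric matrix of a quadratic form $q$, and $\phi(t)=\det\mathrm{Matrix}(tf+g)=\Phi_{30}t^3+\Phi_{21}t^2+\Phi_{12}t+\Phi_{03}$. Define $\psi(t)$ by $\det(vI-\mathrm{Matrix}(tf+g))=v^3-\mu(t)v^2+\psi(t)v-\phi(t)$. Let $P=p_2t^2+p_1t+p_0$ be the remainder in the euclidean division of $\Phi_{30}\,\psi\,\phi'$ by $\phi$, and $$A_1=\begin{vmatrix} \Phi_{30} & \Phi_{21} & \Phi_{12} \\ 0 & p_2 & p_1 \\ p_2 & p_1 & p_0 \end{vmatrix}.$$ *)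

(* Defs.v *)
From HB Require Import structures.
From mathcomp Require Import all_boot all_order all_algebra.
From mathcomp Require Import reals.
From mathcomp Require Export mpoly.

Set Implicit Arguments.
Unset Strict Implicit.
Unset Printing Implicit Defensive.

Import GRing.Theory.
Local Open Scope ring_scope.

(* [qform R] is S^2 (R^3)^*, and a {vspace qform R} of dimension 2 is a
   projective line in P(S^2 (R^3)^* ). *)
Notation qform R := (dhomog 3 R 2).

Notation vx R := ('X_(inord 0) : {mpoly R[3]}).
Notation vy R := ('X_(inord 1) : {mpoly R[3]}).
Notation vz R := ('X_(inord 2) : {mpoly R[3]}).

(* The off-diagonal entries are halves of the coefficients of the mixed
   monomials, so that q(v) = v^T (qmx q) v. The coefficient ring is arbitrary
   because the definition is also applied over {poly R}. *)
Definition qmx (K : comUnitRingType) (q : {mpoly K[3]}) : 'M[K]_3 :=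
  \matrix_(i, j) ((if i == j then 1 else 2%:R^-1) * q@_(U_(i) + U_(j))%MM).

Definition nondegenerate_qform (R : fieldType) (q : qform R) : Prop :=
  \det (qmx q) != 0.

Section LinearSubstitution.
Variable R : fieldType.
Implicit Types (A : 'M[R]_3) (q : qform R).

Definition linear_forms A : 3.-tuple {mpoly R[3]} :=
  [tuple \sum_(j < 3) A i j *: 'X_j | i < 3].

Lemma subst_homog A q :
  ((q : {mpoly R[3]}) \mPo linear_forms A) \is 2.-homog.
Proof.
have hX i : tnth (linear_forms A) i \is 1.-homog.
  rewrite tnth_mktuple; apply: rpred_sum => j _; apply: rpredZ.
  by rewrite dhomogX /= mdeg1.
rewrite comp_mpolyEX big_seq; apply: rpred_sum => m hm; apply: rpredZ.
have dm : mdeg m = 2%N by have /dhomogP/(_ m hm) := valP q.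
rewrite comp_mpolyX -[X in _ \in ishomog1 X _]dm mdegE.
elim/big_rec2: _ => [|i p d _ hp]; first exact: dhomog1.
by apply: dhomogM => //; have := dhomogMn (m i) (hX i); rewrite mul1n.
Qed.

(* q |-> q \o A. *)
Definition subst A q : qform R := DHomog (subst_homog A q).

Lemma subst_is_linear A : linear (subst A).
Proof. by move=> c p q; apply: val_inj; rewrite /= linearP. Qed.

HB.instance Definition _ A :=
  GRing.isLinear.Build R (qform R) (qform R) _ (subst A) (subst_is_linear A).

(* Orbits under PGL(3): scalar matrices act trivially on subspaces, so these
   are the orbits of the substitution action of GL(3). *)
Definition same_orbit (L0 L : {vspace qform R}) : Prop :=
  exists2 A : 'M[R]_3, A \in unitmx & L = (linfun (subst A) @: L0)%VS.

Definition is_pencil (L : {vspace qform R}) : Prop := (\dim L = 2)%N.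

Fact deg1 i : ('X_i : {mpoly R[3]}) \is 1.-homog.
Proof. by rewrite dhomogX /= mdeg1. Qed.

Lemma yz_homog : vy R * vz R \is 2.-homog.
Proof. exact: (dhomogM (deg1 _) (deg1 _)). Qed.

Lemma xyz_homog : vx R * (vy R - vz R) \is 2.-homog.
Proof. exact: (dhomogM (deg1 _) (rpredB (deg1 _) (deg1 _))). Qed.

Lemma y2z2_homog : vy R ^+ 2 + vz R ^+ 2 \is 2.-homog.
Proof. by apply: rpredD; rewrite expr2; apply: (dhomogM (deg1 _) (deg1 _)). Qed.

Lemma xz_homog : vx R * vz R \is 2.-homog.
Proof. exact: (dhomogM (deg1 _) (deg1 _)). Qed.

Definition pencil_II : {vspace qform R} :=
  <<[:: DHomog yz_homog; DHomog xyz_homog]>>%VS.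

Definition pencil_IIa : {vspace qform R} :=
  <<[:: DHomog y2z2_homog; DHomog xz_homog]>>%VS.

Definition in_orbit_II (L : {vspace qform R}) := same_orbit pencil_II L.

Definition in_orbit_IIa (L : {vspace qform R}) := same_orbit pencil_IIa L.

End LinearSubstitution.

Section PencilInvariants.
Variables (R : fieldType) (f g : qform R).

(* The indeterminate t is the variable 'X of {poly R}. *)
Definition pencil_mx : 'M[{poly R}]_3 :=
  qmx ('X *: map_mpoly polyC f + map_mpoly polyC g).

Definition phi : {poly R} := \det pencil_mx.

Definition Phi30 : R := phi`_3.
Definition Phi21 : R := phi`_2.
Definition Phi12 : R := phi`_1.
Definition Phi03 : R := phi`_0.

(* [char_poly M] is det(v I - M), a polynomial in v over {poly R}. *)
Definition psi : {poly R} := (char_poly pencil_mx)`_1.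

Definition remP : {poly R} := (Phi30 *: (psi * phi^`())) %% phi.

Definition p2 : R := remP`_2.
Definition p1 : R := remP`_1.
Definition p0 : R := remP`_0.

Definition A1 : R :=
  \det (\matrix_(i < 3, j < 3)
    (nth [::] [:: [:: Phi30; Phi21; Phi12];
                  [:: 0    ; p2   ; p1   ];
                  [:: p2   ; p1   ; p0   ]] i)`_j).

End PencilInvariants.

(* Main.v *)
From HB Require Import structures.
Require Import Defs.
From mathcomp Require Import all_boot all_order all_algebra.
From mathcomp Require Import reals.
From mathcomp Require Import ring lra.
Import Order.TTheory GRing.Theory Num.Theory.
Local Open Scope ring_scope.

(** A pencil in orbit II or IIa is spanned by the images [M] and [N], under a
    linear substitution [A], of two explicit degenerate conics for which
    [det (a M + b N)] is a negative multiple of [a b ^ 2]. With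
    [f = a1 M + b1 N] and [g = a2 M + b2 N] this gives
    [phi = c (t - t1)^2 (t - t2)], where [t1 = - b2 / b1] is the parameter of a
    multiple of [M], [t2 = - a2 / a1] is the parameter of a multiple of [N], and
    [c = Phi30].

    The remainder [P] of [c psi phi'] is then determined by [P(t1) = 0] and by
    the values of [P'(t1)] and [P(t2)], which involve [psi] only through
    [psi(t1)] and [psi(t2)]. Solving for the coefficients of [P]
    ([remainder_coefs], [remainder_det]),
<<
      p2 = c^2 (2 psi(t1) + psi(t2)),
      c A1 = 2 (c^3 (t1 - t2))^2 psi(t1) psi(t2).
>>
    So only the signs of [psi(t1)] and [psi(t2)] matter. Up to a positive square,
    these are the second elementary symmetric functions of the eigenvalues of [M]
    and [N], which are matrices of rank 2: the function is negative for a product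
    of two independent linear forms and positive for a sum of two squares
    ([e2_sym_prod], [e2_sum_squares], [cross_sqnorm_gt0]). The two degenerate
    conics of orbit II are both real line pairs, so both signs are negative. In
    orbit IIa the double root carries the sum of squares and the simple root the
    real line pair, so the signs are opposite and [c A1] is negative. *)

Set Implicit Arguments.
Unset Strict Implicit.
Unset Printing Implicit Defensive.

(** * Determinants and characteristic polynomials in dimension 3 *)

Lemma ord3P (P : 'I_3 -> Prop) : P 0 -> P 1 -> P 2 -> forall i, P i.
Proof.
move=> P0 P1 P2 [[|[|[|//]]] h].
- by rewrite (_ : Ordinal h = 0) //; apply: val_inj.
- by rewrite (_ : Ordinal h = 1) //; apply: val_inj.
by rewrite (_ : Ordinal h = 2) //; apply: val_inj.
Qed.

Lemma sum3 (V : nmodType) (F : 'I_3 -> V) : \sum_i F i = F 0 + F 1 + F 2.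
Proof.
rewrite !big_ord_recl big_ord0 addr0 addrA.
by congr (F _ + F _ + F _); apply: val_inj.
Qed.

Lemma det_mx33 (K : comNzRingType) (M : 'M[K]_3) :
  \det M = M 0 0 * (M 1 1 * M 2 2 - M 1 2 * M 2 1)
         - M 0 1 * (M 1 0 * M 2 2 - M 1 2 * M 2 0)
         + M 0 2 * (M 1 0 * M 2 1 - M 1 1 * M 2 0).
Proof.
have det2 (N : 'M[K]_2) : \det N = N 0 0 * N 1 1 - N 0 1 * N 1 0.
  rewrite (expand_det_row _ 0) !big_ord_recl big_ord0 /cofactor !det_mx11 !mxE.
  rewrite (_ : lift 0 0 = 1 :> 'I_2); last exact: val_inj.
  rewrite (_ : lift 1 0 = 0 :> 'I_2); last exact: val_inj.
  by rewrite /= /bump /= expr0 expr1; ring.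
rewrite (expand_det_row _ 0) sum3 /cofactor !det2 !mxE.
have e00 : lift 0 0 = 1 :> 'I_3 by apply: val_inj.
have e01 : lift 0 1 = 2 :> 'I_3 by apply: val_inj.
have e10 : lift 1 0 = 0 :> 'I_3 by apply: val_inj.
have e11 : lift 1 1 = 2 :> 'I_3 by apply: val_inj.
have e20 : lift 2 0 = 0 :> 'I_3 by apply: val_inj.
have e21 : lift 2 1 = 1 :> 'I_3 by apply: val_inj.
by rewrite e00 e01 e10 e11 e20 e21 /=; ring.
Qed.

Lemma char_poly33_1 {K : comNzRingType} (M : 'M[K]_3) :
  (char_poly M)`_1 = M 0 0 * M 1 1 - M 0 1 * M 1 0
                   + (M 0 0 * M 2 2 - M 0 2 * M 2 0)
                   + (M 1 1 * M 2 2 - M 1 2 * M 2 1).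
Proof.
set e := RHS.
have -> : char_poly M =
    'X^3 - (M 0 0 + M 1 1 + M 2 2)%:P * 'X^2 + e%:P * 'X - (\det M)%:P.
  rewrite /char_poly !det_mx33 !mxE /= /e !(mulr1n, mulr0n) !sub0r.
  by rewrite !(rmorphD, rmorphM, rmorphN); ring.
by rewrite !coefE /= mulr0 mulr1; ring.
Qed.

(** The sum of the principal 2-minors is homogeneous of degree 2, so passing to a
    nonzero multiple of a conic does not change its sign. *)
Lemma char_poly33_1Z (K : comNzRingType) (a : K) (M : 'M[K]_3) :
  (char_poly (a *: M))`_1 = a ^+ 2 * (char_poly M)`_1.
Proof. by rewrite !char_poly33_1 !mxE; ring. Qed.

(** * The remainder when phi has a double root *)

Section DoubleRootRemainder.
Variables (K : fieldType) (c t1 t2 : K) (F G : {poly K}).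
Hypothesis c0 : c != 0.
Hypothesis t12 : t1 != t2.
Hypothesis defF : F = c%:P * ('X - t1%:P) ^+ 2 * ('X - t2%:P).
Let P := (c *: (G * F^`())) %% F.

Lemma cubic_coefs : [/\ F`_3 = c, F`_2 = - c * (2 * t1 + t2) &
  F`_1 = c * (t1 ^+ 2 + 2 * t1 * t2)].
Proof.
have -> : F = c%:P * 'X^3 - (c * (2 * t1 + t2))%:P * 'X^2
   + (c * (t1 ^+ 2 + 2 * t1 * t2))%:P * 'X - (c * t1 ^+ 2 * t2)%:P.
  by rewrite defF !(rmorphD, rmorphM, rmorphN, rmorphXn, rmorph_nat) /=; ring.
by split; rewrite !coefE /=; ring.
Qed.

Lemma size_cubic : size F = 4%N.
Proof.
rewrite defF -mulrA size_Cmul // size_Mmonic ?monicXsubC //; last first.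
  by rewrite expf_neq0 // polyXsubC_eq0.
by rewrite size_exp_XsubC size_XsubC.
Qed.

Lemma remainderE : P = P`_2 *: 'X^2 + P`_1 *: 'X + (P`_0)%:P.
Proof.
have sP : (size P <= 3)%N.
  by rewrite -ltnS -size_cubic ltn_modpN0 // -size_poly_eq0 size_cubic.
apply/polyP=> -[|[|[|i]]]; rewrite !coefE /=.
all: rewrite ?mulr0 ?mulr1 ?addr0 ?add0r //.
by rewrite nth_default // (leq_trans sP).
Qed.

(** Since [F] vanishes to order 2 at [t1] and to order 1 at [t2], these values are
    those of [c G F'] and of its derivative. Terms containing [F' t1] vanish, which
    is why no derivative of [G] appears. *)
Lemma remainder_conditions :
  [/\ P.[t1] = 0, P.[t2] = c ^+ 2 * G.[t2] * (t2 - t1) ^+ 2 &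
      P^`().[t1] = 2 * c ^+ 2 * G.[t1] * (t1 - t2)].
Proof.
have defP : P = c *: (G * F^`()) - (c *: (G * F^`())) %/ F * F.
  by apply: (addrI (c *: (G * F^`()) %/ F * F)); rewrite /P -divp_eq addrC subrK.
have dF : F^`() = c%:P * ('X - t1%:P) * (2%:P * ('X - t2%:P) + ('X - t1%:P)).
  rewrite defF !expr2 !derivE ?(mul0r, add0r, subr0, mulr1).
  rewrite !rmorph_nat; ring.
move: defP dF; set Q := _ %/ F => -> dF; rewrite dF [X in Q * X]defF.
split; rewrite ?(derivD, derivN, derivZ, derivM, derivX, derivC, expr2);
  rewrite !hornerE /=; ring.
Qed.

Lemma remainder_coefs :
  [/\ P`_2 = c ^+ 2 * (2 * G.[t1] + G.[t2]),
      P`_1 = 2 * c ^+ 2 * G.[t1] * (t1 - t2) - 2 * P`_2 * t1 &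
      P`_0 = - P`_2 * t1 ^+ 2 - P`_1 * t1].
Proof.
have [] := remainder_conditions.
have PE x : P.[x] = P`_2 * x ^+ 2 + P`_1 * x + P`_0.
  by rewrite {1}remainderE !hornerE.
have dPE x : P^`().[x] = 2 * P`_2 * x + P`_1.
  by rewrite {1}remainderE !derivE !hornerE /=; ring.
rewrite !PE dPE => h1 h2 h3.
have d0 : (t2 - t1) ^+ 2 != 0 by rewrite expf_neq0 // subr_eq0 eq_sym.
have e1 : P`_1 = 2 * c ^+ 2 * G.[t1] * (t1 - t2) - 2 * P`_2 * t1.
  by rewrite -h3; ring.
have e0 : P`_0 = - P`_2 * t1 ^+ 2 - P`_1 * t1.
  by apply/eqP; rewrite -subr_eq0 -[eqbRHS]h1; apply/eqP; ring.
(* The Taylor expansion of P at t1 gives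
   P`_2 (t2 - t1)^2 = P(t2) - P(t1) - P'(t1) (t2 - t1). *)
split=> //; apply: (mulIf d0).
transitivity (P`_2 * t2 ^+ 2 + P`_1 * t2 + P`_0
   - 2 * c ^+ 2 * G.[t1] * (t1 - t2) * (t2 - t1)).
  by rewrite e0 e1; ring.
by rewrite h2; ring.
Qed.

(** Up to a power of [c], the determinant is the first subresultant of [F] and [P].
    For [P = p (X - t1) (X - s)] it is a multiple of [(t1 - s) (s - t2)], that is,
    of the product of the values of [P / (X - t1)] at [t1] and [t2]. *)
Lemma remainder_det :
  c * \det (\matrix_(i < 3, j < 3)
    (nth [::] [:: [:: c; F`_2; F`_1];
                  [:: 0    ; P`_2   ; P`_1   ];
                  [:: P`_2   ; P`_1   ; P`_0   ]] i)`_j) =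
  2 * (c ^+ 3 * (t1 - t2)) ^+ 2 * (G.[t1] * G.[t2]).
Proof.
have [_ F2 F1] := cubic_coefs; have [P2 P1 P0] := remainder_coefs.
by rewrite det_mx33 !mxE /= F2 F1 P0 P1 P2; ring.
Qed.
End DoubleRootRemainder.

(** * Matrices of products of linear forms *)

Definition linform (K : nzRingType) (u : 'rV[K]_3) : {mpoly K[3]} :=
  \sum_j u 0 j *: 'X_j.

Definition sym_prod (K : fieldType) (u v : 'rV[K]_3) : 'M[K]_3 :=
  2^-1 *: (u^T *m v + v^T *m u).

Lemma eq_mnm1D n (a b k l : 'I_n) :
  (U_(a) + U_(b) == U_(k) + U_(l))%MM =
  (a == k) && (b == l) || (a == l) && (b == k).
Proof.
apply/idP/idP=> [/eqP E|/orP[] /andP[/eqP-> /eqP->] //]; last by rewrite addmC.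
have cancel c d e : (U_(c) + U_(d) = U_(c) + U_(e) :> 'X_{1.. n})%MM -> d = e.
  move/(congr1 (fun m : 'X_{1.. n} => m d)); rewrite !mnmDE !mnm1E eqxx.
  by move/addnI/eqP; case: (e =P d).
have := congr1 (fun m : 'X_{1.. n} => m a) E; rewrite !mnmDE !mnm1E eqxx.
case: (k =P a) => [ka _|_].
  by rewrite -ka in E *; rewrite (cancel _ _ _ E) !eqxx.
case: (l =P a) => [la _|] //.
rewrite -la addmC in E *; move: E; rewrite addmC [in RHS]addmC => /cancel->.
by rewrite !eqxx orbT.
Qed.

Lemma qmx_is_linear (K : comUnitRingType) c (p q : {mpoly K[3]}) :
  qmx (c *: p + q) = c *: qmx p + qmx q.
Proof. by apply/matrixP=> i j; rewrite !mxE mcoeffD mcoeffZ mulrDr mulrCA. Qed.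

HB.instance Definition _ (K : comUnitRingType) :=
  GRing.isLinear.Build K {mpoly K[3]} 'M[K]_3 _ (@qmx K) (@qmx_is_linear K).

Section RealForms.
Variable R : realFieldType.
Implicit Types (u v : 'rV[R]_3) (A : 'M[R]_3).

Lemma qmx_mul_linform u v : qmx (linform u * linform v) = sym_prod u v.
Proof.
apply/matrixP=> k l; rewrite !mxE !big_ord1 !mxE.
have -> : (linform u * linform v)@_(U_(k) + U_(l)) =
    \sum_i \sum_j u 0 i * v 0 j * (((i == k) && (j == l)) || (i == l) && (j == k))%:R.
  rewrite /linform mulr_suml raddf_sum; apply: eq_bigr => i _.
  rewrite mulr_sumr raddf_sum; apply: eq_bigr => j _ /=.
  by rewrite -scalerAl -scalerAr scalerA mcoeffZ -mpolyXD mcoeffX eq_mnm1D.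
rewrite !sum3.
move: k l; apply: ord3P; apply: ord3P; by rewrite /=; field.
Qed.

Lemma linform_delta i : linform (delta_mx 0 i) = 'X_i :> {mpoly R[3]}.
Proof.
rewrite /linform (bigD1 i) //= mxE !eqxx scale1r big1 ?addr0 // => j ji.
by rewrite mxE eqxx (negbTE ji) scale0r.
Qed.

Lemma linformB u v : linform (u - v) = linform u - linform v.
Proof.
by rewrite /linform -sumrB; apply: eq_bigr => j _; rewrite !mxE scalerBl.
Qed.

Lemma linform_subst A u : linform u \mPo linear_forms A = linform (u *m A).
Proof.
rewrite /linform raddf_sum /=.
under eq_bigr => i _ do rewrite comp_mpolyZ comp_mpolyXU -tnth_nth tnth_mktuple scaler_sumr.
rewrite exchange_big; apply: eq_bigr => j _; rewrite mxE scaler_suml.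
by apply: eq_bigr => i _; rewrite scalerA.
Qed.

Lemma sym_prod_congr A u v : sym_prod (u *m A) (v *m A) = A^T *m sym_prod u v *m A.
Proof.
rewrite /sym_prod -scalemxAr -scalemxAl mulmxDr mulmxDl !trmx_mul.
by rewrite !mulmxA.
Qed.

(** The squared norm of the cross product of [u] and [v]. *)
Definition cross_sqnorm u v : R :=
  (u 0 0 * v 0 1 - u 0 1 * v 0 0) ^+ 2
  + (u 0 0 * v 0 2 - u 0 2 * v 0 0) ^+ 2
  + (u 0 1 * v 0 2 - u 0 2 * v 0 1) ^+ 2.

(** A product of two independent linear forms has signature (1, 1), so the product
    of its two nonzero eigenvalues is negative. *)
Lemma e2_sym_prod u v :
  (char_poly (sym_prod u v))`_1 = - 4^-1 * cross_sqnorm u v.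
Proof.
by rewrite char_poly33_1 !mxE !big_ord1 !mxE /cross_sqnorm; field.
Qed.

(** This is the Gram determinant of [u] and [v] by Lagrange's identity. *)
Lemma e2_sum_squares u v :
  (char_poly (sym_prod u u + sym_prod v v))`_1 = cross_sqnorm u v.
Proof.
by rewrite char_poly33_1 !mxE !big_ord1 !mxE /cross_sqnorm; field.
Qed.

Definition independent u v := forall a b, a *: u = b *: v -> a = 0 /\ b = 0.

Lemma independentM A u v : A \in unitmx -> independent u v ->
  independent (u *m A) (v *m A).
Proof.
move=> uA ind a b; rewrite !scalemxAl => /(can_inj (mulmxK uA)); exact: ind.
Qed.

Lemma cross_sqnorm_gt0 u v : independent u v -> 0 < cross_sqnorm u v.
Proof.
move=> ind; rewrite lt_neqAle eq_sym /cross_sqnorm !addr_ge0 ?sqr_ge0 // andbT.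
apply/negP; rewrite !paddr_eq0 ?addr_ge0 ?sqr_ge0 // !sqrf_eq0 !subr_eq0.
case/andP=> /andP[/eqP h01 /eqP h02] /eqP h12.
(* The vanishing 2-minors say that v_k u = u_k v for every k. *)
have v0 : v = 0.
  apply/rowP=> k; rewrite mxE.
  have [] // : v 0 k = 0 /\ u 0 k = 0.
  apply: ind; apply/rowP=> l; rewrite !mxE.
  by move: k l; do 2![apply: ord3P]; lra.
have [_ /eqP] : (0 : R) = 0 /\ (1 : R) = 0 by apply: ind; rewrite v0 scaler0 scale0r.
by rewrite oner_eq0.
Qed.
End RealForms.

(** * Pencils generated by two degenerate conics *)

Section Pencils.
Variable R : realFieldType.
Implicit Types (f g q : qform R) (A : 'M[R]_3).

Lemma pencil_mxE f g :
  pencil_mx f g = 'X *: map_mx polyC (qmx f) + map_mx polyC (qmx g).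
Proof.
rewrite /pencil_mx linearP; congr (_ *: _ + _).
all: apply/matrixP=> i j; rewrite !mxE mcoeff_map_mpoly polyCM.
all: by case: (i == j); rewrite -?polyCV -?(rmorph_nat polyC).
Qed.

Lemma psi_horner f g t :
  (psi f g).[t] = (char_poly (t *: qmx f + qmx g))`_1.
Proof.
rewrite /psi -horner_evalE -coef_map map_char_poly pencil_mxE.
congr (nth _ (polyseq (char_poly _)) _).
by apply/matrixP=> i j; rewrite !mxE /= /horner_eval hornerD hornerM hornerX !hornerC.
Qed.

Lemma det_pencil_congr (a b : {poly R}) A (M N : 'M[R]_3) :
  \det (a *: map_mx polyC (A^T *m M *m A) + b *: map_mx polyC (A^T *m N *m A))
  = (\det A ^+ 2)%:P * \det (a *: map_mx polyC M + b *: map_mx polyC N).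
Proof.
transitivity (\det (map_mx polyC A^T *m
    (a *: map_mx polyC M + b *: map_mx polyC N) *m map_mx polyC A)).
  by rewrite mulmxDr mulmxDl -!scalemxAr -!scalemxAl !map_mxM.
by rewrite !det_mulmx !det_map_mx det_tr rmorphXn /=; ring.
Qed.

Lemma mem_span2 (V : vectType R) (p q v : V) :
  v \in <<[:: p; q]>>%VS -> exists a b, v = a *: p + b *: q.
Proof.
rewrite span_cons span_seq1 => /memv_addP[_ /vlineP[a ->] [_ /vlineP[b ->] ->]].
by exists a, b.
Qed.

(** In the pencil, the multiple of [M] sits at the double root of [phi] and the
    multiple of [N] at the simple root, because [b] is squared in the determinant. *)
Lemma pencil_invariants f g (M N : 'M[R]_3) a1 a2 b1 b2 k :
    qmx f = a1 *: M + b1 *: N -> qmx g = a2 *: M + b2 *: N ->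
    (forall a b : {poly R},
      \det (a *: map_mx polyC M + b *: map_mx polyC N) = k%:P * a * b ^+ 2) ->
    nondegenerate_qform f -> a1 * b2 != a2 * b1 ->
  exists r s t : R, [/\ [/\ 0 < r, 0 < s & 0 < t],
    p2 f g = r * (char_poly M)`_1 + s * (char_poly N)`_1 &
    Phi30 f g * A1 f g = t * ((char_poly M)`_1 * (char_poly N)`_1)].
Proof.
move=> fE gE detMN fN0 dN0.
(* The leading coefficient of phi is the determinant of the matrix of f. *)
have : k * a1 * b1 ^+ 2 != 0.
  have := detMN a1%:P b1%:P.
  have -> : a1%:P *: map_mx polyC M + b1%:P *: map_mx polyC N
          = map_mx polyC (qmx f).
    by rewrite fE map_mxD !map_mxZ.
  rewrite det_map_mx -[b1%:P ^+ 2]rmorphXn -!polyCM => /polyC_inj <-; exact: fN0.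
rewrite !mulf_eq0 !negb_or => /andP[/andP[k0 a10] /andP[b10 _]].
pose c := k * a1 * b1 ^+ 2; pose t1 := - b2 / b1; pose t2 := - a2 / a1.
have c0 : c != 0 by rewrite !mulf_neq0.
have t12 : t1 != t2.
  rewrite -subr_eq0 (_ : t1 - t2 = (a2 * b1 - a1 * b2) / (a1 * b1)).
    by rewrite mulf_neq0 ?invr_eq0 ?mulf_neq0 // subr_eq0 eq_sym.
  by rewrite /t1 /t2; field; rewrite a10 b10.
have phiE : phi f g = c%:P * ('X - t1%:P) ^+ 2 * ('X - t2%:P).
  have aE : a1%:P * ('X - t2%:P) = a1%:P * 'X + a2%:P.
    by rewrite mulrBr -polyCM /t2 mulrCA mulfV // mulr1 polyCN opprK.
  have bE : b1%:P * ('X - t1%:P) = b1%:P * 'X + b2%:P.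
    by rewrite mulrBr -polyCM /t1 mulrCA mulfV // mulr1 polyCN opprK.
  transitivity (k%:P * (a1%:P * 'X + a2%:P) * (b1%:P * 'X + b2%:P) ^+ 2).
    rewrite -detMN /phi pencil_mxE fE gE !map_mxD !map_mxZ; congr (\det _).
    by apply/matrixP=> i j; rewrite !mxE; ring.
  by rewrite -aE -bE /c !polyCM; ring.
have psi1 : (psi f g).[t1] = (a2 + t1 * a1) ^+ 2 * (char_poly M)`_1.
  rewrite psi_horner -char_poly33_1Z; set X := _ + _; set Y := _ *: _.
  suff -> : X = Y by [].
  rewrite /X /Y fE gE.
  by apply/matrixP=> i j; rewrite !mxE /t1; field.
have psi2 : (psi f g).[t2] = (b2 + t2 * b1) ^+ 2 * (char_poly N)`_1.
  rewrite psi_horner -char_poly33_1Z; set X := _ + _; set Y := _ *: _.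
  suff -> : X = Y by [].
  rewrite /X /Y fE gE.
  by apply/matrixP=> i j; rewrite !mxE /t2; field.
have [PhiE _ _] := cubic_coefs phiE; rewrite -/(Phi30 f g) in PhiE.
have [p2E _ _] := remainder_coefs (psi f g) c0 t12 phiE.
have detE := remainder_det (psi f g) c0 t12 phiE.
have sqr_gt0 (x : R) : x != 0 -> 0 < x ^+ 2 by move=> x0; rewrite exprn_even_gt0.
have c1 : 0 < (a2 + t1 * a1) ^+ 2.
  apply: sqr_gt0; rewrite (_ : _ + _ = (a2 * b1 - a1 * b2) / b1).
    by rewrite mulf_neq0 ?invr_eq0 // subr_eq0 eq_sym.
  by rewrite /t1; field.
have c2 : 0 < (b2 + t2 * b1) ^+ 2.
  apply: sqr_gt0; rewrite (_ : _ + _ = (a1 * b2 - a2 * b1) / a1).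
    by rewrite mulf_neq0 ?invr_eq0 // subr_eq0.
  by rewrite /t2; field.
exists (2 * c ^+ 2 * (a2 + t1 * a1) ^+ 2), (c ^+ 2 * (b2 + t2 * b1) ^+ 2).
exists (2 * (c ^+ 3 * (t1 - t2)) ^+ 2
        * ((a2 + t1 * a1) ^+ 2 * (b2 + t2 * b1) ^+ 2)); split.
- have two0 : 0 < 2 :> R by rewrite ltr0n.
  have cc := sqr_gt0 _ c0.
  have dd : 0 < (c ^+ 3 * (t1 - t2)) ^+ 2.
    by apply: sqr_gt0; rewrite mulf_neq0 ?expf_neq0 // subr_eq0.
  by split; repeat (assumption || apply: mulr_gt0).
- by rewrite /p2 /remP PhiE p2E psi1 psi2; ring.
rewrite /A1 /p2 /p1 /p0 /remP /Phi21 /Phi12 PhiE detE psi1 psi2; ring.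
Qed.

(** [pencil_invariants] transported to the orbit of the pencil of [q1] and [q2]:
    the substitution multiplies the determinant by the positive [det A ^ 2], while
    the characteristic polynomials have to be taken after substitution, as they
    are not invariant. *)
Lemma orbit_invariants f g q1 q2 A :
    is_pencil <<[:: f; g]>>%VS -> nondegenerate_qform f ->
    <<[:: f; g]>>%VS = (linfun (subst A) @: <<[:: q1; q2]>>)%VS ->
    A \in unitmx ->
    qmx (subst A q1) = A^T *m qmx q1 *m A ->
    qmx (subst A q2) = A^T *m qmx q2 *m A ->
    (forall a b : {poly R},
      \det (a *: map_mx polyC (qmx q1) + b *: map_mx polyC (qmx q2))
      = (- 4^-1)%:P * a * b ^+ 2) ->
  exists r s t : R, [/\ [/\ 0 < r, 0 < s & 0 < t],
    p2 f g = r * (char_poly (qmx (subst A q1)))`_1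
           + s * (char_poly (qmx (subst A q2)))`_1 &
    Phi30 f g * A1 f g = t * ((char_poly (qmx (subst A q1)))`_1
                             * (char_poly (qmx (subst A q2)))`_1)].
Proof.
rewrite limg_span /= !lfunE /= => dimL fN0 LE uA q1A q2A detq.
have [|a1 [b1 fE]] := @mem_span2 _ (subst A q1) (subst A q2) f.
  by rewrite -LE memv_span // inE eqxx.
have [|a2 [b2 gE]] := @mem_span2 _ (subst A q1) (subst A q2) g.
  by rewrite -LE memv_span // !inE eqxx orbT.
have qmxE h a b : h = a *: subst A q1 + b *: subst A q2 :> qform R ->
    qmx h = a *: qmx (subst A q1) + b *: qmx (subst A q2).
  by move=> ->; rewrite /= !(linearD, linearZ) /=.
apply: (@pencil_invariants f g _ _ a1 a2 b1 b2 (- 4^-1 * \det A ^+ 2)).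
- exact: qmxE.
- exact: qmxE.
- by move=> a b; rewrite q1A q2A det_pencil_congr detq !polyCM; ring.
- exact: fN0.
(* If the coordinates of f and g were proportional, so would be f and g. *)
apply/negP=> /eqP d0.
have : free [:: f; g] by rewrite /free; apply/eqP.
rewrite free_cons span_seq1 seq1_free => /andP[/negP f_g g0]; apply: f_g.
apply/vlineP; have [a20|a20] := eqVneq a2 0; last first.
  exists (a1 / a2); rewrite gE scalerDr !scalerA divfK // mulrAC d0 mulrAC divff //.
  by rewrite mul1r.
have [b20|b20] := eqVneq b2 0; first by rewrite gE a20 b20 !scale0r addr0 eqxx in g0.
exists (b1 / b2); rewrite gE scalerDr !scalerA divfK // mulrAC [b1 * _]mulrC -d0 mulfK //.
Qed.

Lemma qmx_subst_mul A u v (p := linform u * linform v) :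
  qmx (p \mPo linear_forms A) = sym_prod (u *m A) (v *m A).
Proof. by rewrite /p rmorphM /= !linform_subst qmx_mul_linform. Qed.

(** * The generators of the two orbits *)

Let e (i : 'I_3) : 'rV[R]_3 := delta_mx 0 i.

Lemma generatorsE :
  [/\ vy R * vz R = linform (e 1) * linform (e 2),
      vx R * (vy R - vz R) = linform (e 0) * linform (e 1 - e 2),
      vy R ^+ 2 + vz R ^+ 2
        = linform (e 1) * linform (e 1) + linform (e 2) * linform (e 2) &
      vx R * vz R = linform (e 0) * linform (e 2)].
Proof.
have inordE (i : 'I_3) : inord i = i by rewrite inord_val.
by rewrite (inordE 0) (inordE 1) (inordE 2) linformB !linform_delta.
Qed.

Lemma independent_delta i j (w : 'rV[R]_3) : w 0 i = 0 -> w 0 j != 0 -> i != j ->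
  independent (e i) w.
Proof.
move=> wi wj ij a b E.
have := congr1 (fun r : 'rV_3 => r 0 i) E; rewrite !mxE !eqxx wi mulr0 mulr1 => a0.
have /esym/eqP := congr1 (fun r : 'rV_3 => r 0 j) E.
by rewrite !mxE a0 mul0r mulf_eq0 (negbTE wj) orbF => /eqP.
Qed.

Lemma det_generators_II (a b : {poly R}) :
  \det (a *: map_mx polyC (sym_prod (e 1) (e 2))
        + b *: map_mx polyC (sym_prod (e 0) (e 1 - e 2)))
  = (- 4^-1)%:P * a * b ^+ 2.
Proof.
rewrite det_mx33 !mxE !big_ord1 !mxE /=.
(* All entries are multiples of 1/2, so the determinant comes out as -2 (1/2)^3. *)
have -> : 4^-1 = (1 + 1) * (2^-1 * 2^-1 * 2^-1) :> R by field.
rewrite !(mulr0, mul0r, mulr1, mul1r, addr0, add0r, subr0, sub0r).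
by rewrite !(polyCN, polyCM, polyC0, polyC1, polyCD); ring.
Qed.

Lemma det_generators_IIa (a b : {poly R}) :
  \det (a *: map_mx polyC (sym_prod (e 1) (e 1) + sym_prod (e 2) (e 2))
        + b *: map_mx polyC (sym_prod (e 0) (e 2)))
  = (- 4^-1)%:P * a * b ^+ 2.
Proof.
rewrite det_mx33 !mxE !big_ord1 !mxE /=.
have -> : 4^-1 = 2^-1 * 2^-1 :> R by field.
have -> : 2^-1 * (1 * 1 + 1 * 1) = 1 :> R by field.
rewrite !(mulr0, mul0r, mulr1, mul1r, addr0, add0r).
by rewrite !(polyCN, polyCM, polyC0, polyC1, polyCD); ring.
Qed.

(** Both degenerate conics are real line pairs. *)
Lemma orbit_II_signs f g :
  is_pencil <<[:: f; g]>>%VS -> nondegenerate_qform f ->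
  in_orbit_II <<[:: f; g]>>%VS -> p2 f g < 0 /\ 0 < Phi30 f g * A1 f g.
Proof.
move=> dimL fN0 [A uA LE]; have [yzE xyzE _ _] := generatorsE.
have q1E : qmx (vy R * vz R) = sym_prod (e 1) (e 2).
  by rewrite yzE qmx_mul_linform.
have q2E : qmx (vx R * (vy R - vz R)) = sym_prod (e 0) (e 1 - e 2).
  by rewrite xyzE qmx_mul_linform.
have q1AE : qmx (subst A (DHomog (yz_homog R))) = sym_prod (e 1 *m A) (e 2 *m A).
  by rewrite /= yzE qmx_subst_mul.
have q2AE : qmx (subst A (DHomog (xyz_homog R)))
          = sym_prod (e 0 *m A) ((e 1 - e 2) *m A).
  by rewrite /= xyzE qmx_subst_mul.
have [||a b|r [s [t [[r0 s0 t0] -> ->]]]] := orbit_invariants dimL fN0 LE uA.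
- by rewrite q1AE q1E sym_prod_congr.
- by rewrite q2AE q2E sym_prod_congr.
- by rewrite q1E q2E det_generators_II.
rewrite q1AE e2_sym_prod q2AE e2_sym_prod.
have ind12 : independent (e 1) (e 2).
  by apply: (@independent_delta 1 2); rewrite // !mxE //= oner_neq0.
have ind012 : independent (e 0) (e 1 - e 2).
  by apply: (@independent_delta 0 1); rewrite // !mxE ?subr0 //= oner_neq0.
have x0 := cross_sqnorm_gt0 (independentM uA ind12).
have y0 := cross_sqnorm_gt0 (independentM uA ind012).
have rx := mulr_gt0 r0 x0; have sy := mulr_gt0 s0 y0.
have txy := mulr_gt0 t0 (mulr_gt0 x0 y0).
split; lra.
Qed.

(** The double root carries a sum of two squares, the simple root a real line
    pair. *)
Lemma orbit_IIa_sign f g :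
  is_pencil <<[:: f; g]>>%VS -> nondegenerate_qform f ->
  in_orbit_IIa <<[:: f; g]>>%VS -> Phi30 f g * A1 f g < 0.
Proof.
move=> dimL fN0 [A uA LE]; have [_ _ y2z2E xzE] := generatorsE.
have q1E : qmx (vy R ^+ 2 + vz R ^+ 2)
         = sym_prod (e 1) (e 1) + sym_prod (e 2) (e 2).
  by rewrite y2z2E linearD /= !qmx_mul_linform.
have q2E : qmx (vx R * vz R) = sym_prod (e 0) (e 2).
  by rewrite xzE qmx_mul_linform.
have q1AE : qmx (subst A (DHomog (y2z2_homog R)))
    = sym_prod (e 1 *m A) (e 1 *m A) + sym_prod (e 2 *m A) (e 2 *m A).
  by rewrite /= y2z2E rmorphD linearD /= !qmx_subst_mul.
have q2AE : qmx (subst A (DHomog (xz_homog R))) = sym_prod (e 0 *m A) (e 2 *m A).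
  by rewrite /= xzE qmx_subst_mul.
have [||a b|r [s [t [[_ _ t0] _ ->]]]] := orbit_invariants dimL fN0 LE uA.
- by rewrite q1AE q1E mulmxDr mulmxDl !sym_prod_congr.
- by rewrite q2AE q2E sym_prod_congr.
- by rewrite q1E q2E det_generators_IIa.
rewrite q1AE e2_sum_squares q2AE e2_sym_prod.
have ind12 : independent (e 1) (e 2).
  by apply: (@independent_delta 1 2); rewrite // !mxE //= oner_neq0.
have ind02 : independent (e 0) (e 2).
  by apply: (@independent_delta 0 2); rewrite // !mxE //= oner_neq0.
have x0 := cross_sqnorm_gt0 (independentM uA ind12).
have y0 := cross_sqnorm_gt0 (independentM uA ind02).
have txy := mulr_gt0 t0 (mulr_gt0 x0 y0).
lra.
Qed.

End Pencils.

Unset Implicit Arguments.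

Theorem proposition5 (R : realType) (f g : qform R)
    (hf : nondegenerate_qform f) (hg : nondegenerate_qform g)
    (hfg : is_pencil <<[:: f; g]>>%VS)
    (horb : in_orbit_II <<[:: f; g]>>%VS \/ in_orbit_IIa <<[:: f; g]>>%VS) :
  (in_orbit_II <<[:: f; g]>>%VS -> p2 f g < 0 /\ 0 < Phi30 f g * A1 f g) /\
  (in_orbit_IIa <<[:: f; g]>>%VS -> p2 f g = 0 \/ Phi30 f g * A1 f g < 0).
Proof.
split=> orb; first exact: orbit_II_signs.
by right; apply: orbit_IIa_sign.
Qed.
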